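(* For every fixed integer $r\ge 1$ there is a constant $C_r>0$ such that the following holds. Let $n\ge 1$ and let $\mathbf a=(a_1,\dots,a_n)$ be real numbers such that for all disjoint subsets $x,y\subset[n]$, not both empty, with $|x|+|y|\le 2r$, we have $\sum_{i\in x}a_i\ne\sum_{j\in y}a_j$. Then \[\rho(\mathbf a):=\max_{\alpha\in\mathbb R}\Pr\big[\epsilon_1a_1+\cdots+\epsilon_na_n=\alpha\big]\le C_r\, n^{-r-1/2},\] where $\epsilon_1,\dots,\epsilon_n$ are independent random variables with $\Pr[\epsilon_i=0]=\Pr[\epsilon_i=1]=1/2$.
   Context: $[n]=\{1,\dots,n\}$. *)

(* Defs.v *)
From HB Require Import structures.
From mathcomp Require Import all_boot all_order all_algebra.
From mathcomp Require Import reals.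
Set Implicit Arguments. Unset Strict Implicit. Unset Printing Implicit Defensive.
Import Order.TTheory GRing.Theory Num.Theory.
Local Open Scope ring_scope.

Definition prob_sum_eq (R : realType) (n : nat) (a : 'I_n -> R) (alpha : R) : R :=
  #|[set e : {ffun 'I_n -> bool} | \sum_(i < n) (e i)%:R * a i == alpha]|%:R
  / (2 ^+ n).

(* Main.v *)
Require Import Defs.
From HB Require Import structures.
From mathcomp Require Import all_boot all_order all_algebra.
From mathcomp Require Import reals.
From mathcomp Require Import zify ring lra.
Import Order.TTheory GRing.Theory Num.Theory.
Local Open Scope ring_scope.

Set Implicit Arguments.
Unset Strict Implicit.
Unset Printing Implicit Defensive.

(* Identify outcomes with subsets of the index set and let F be the family of
   subsets of sum alpha.  The hypothesis says that distinct members of F differ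
   in more than 2r places.  Let L consist of the n/2 indices with smallest |a_i|,
   and let m be a threshold separating |a_i| on L from |a_i| outside L.  Flipping
   r coordinates of L in a member of F in all possible ways produces
   |F| * C(n/2, r) distinct subsets, whose sums all lie in [alpha - rm, alpha + rm].
   Once the trace on L is fixed, the Erdos-Littlewood-Offord argument on the
   complement of L, where |a_i| >= m, leaves at most (2r+1) O(2^(n/2) / sqrt n)
   such subsets, so |F| * C(n/2, r) = O(2^n / sqrt n). *)

(** * Upper bounds for binomial coefficients *)

Lemma central_bin_rec m : (m.+1 * 'C(m.+1.*2, m.+1) = 2 * (m.*2.+1) * 'C(m.*2, m))%N.
Proof.
have E1 := mul_bin_diag m.+1.*2 m; rewrite doubleS /= in E1.
have E2 := mul_bin_down m.*2.+1 m.
rewrite /= (_ : m.*2.+1 - m = m.+1)%N in E2; last by lia.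
by rewrite doubleS -E1 -mulnA E2 mulnA -doubleS mul2n.
Qed.

(** Passing from [m] to [m.+1] multiplies the left side by [4(2m+1)(2m+3)/(m+1)^2], which is below
    16 because [(2m+1)(2m+3) = 4(m+1)^2 - 1]. *)
Lemma central_bin_le m : (m.*2.+1 * 'C(m.*2, m) ^ 2 <= 16 ^ m)%N.
Proof.
elim: m => [|m IH]; first by [].
rewrite -(@leq_pmul2l (m.+1 ^ 2)) ?expn_gt0 //.
have -> : (m.+1 ^ 2 * ((m.+1).*2.+1 * 'C((m.+1).*2, m.+1) ^ 2) =
  4 * (m.*2.+1 * m.*2.+3) * (m.*2.+1 * 'C(m.*2, m) ^ 2))%N.
  have -> : (m.+1 ^ 2 * ((m.+1).*2.+1 * 'C((m.+1).*2, m.+1) ^ 2) =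
    m.*2.+3 * (m.+1 * 'C((m.+1).*2, m.+1)) ^ 2)%N by rewrite expnMn mulnCA doubleS.
  rewrite central_bin_rec !expnMn; ring.
rewrite (expnS 16) [leqRHS]mulnA leq_mul //.
by rewrite -!muln2 -mulnn; nia.
Qed.

Lemma bin_le_central m j : ('C(m.*2, j) <= 'C(m.*2, m))%N.
Proof.
have up k : (k <= m -> 'C(m.*2, m - k) <= 'C(m.*2, m))%N.
  elim: k => [|k IH] lekm; first by rewrite subn0.
  apply: leq_trans (IH (ltnW lekm)).
  have E := mul_bin_left (m.*2) (m - k.+1).
  have Ek : (m - k = (m - k.+1).+1)%N by lia.
  rewrite Ek -(@leq_pmul2l (m - k.+1).+1) // E leq_mul2r.
  by apply/orP; right; lia.
have [lejm|ltmj] := leqP j m; first by rewrite -(subKn lejm); apply: up; lia.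
have [lej|] := leqP j m.*2; last by move/bin_small->.
by rewrite -bin_sub // (_ : m.*2 - j = m - (j - m))%N; [apply: up; lia | lia].
Qed.

(** For odd [u = 2m+1], Pascal's rule gives at most twice the central coefficient of row [2m]; the
    factor 2 on the right absorbs [(2m+2)/(2m+1)]. *)
Lemma bin_sqr_le u j : (u.+1 * 'C(u, j) ^ 2 <= 2 * 4 ^ u)%N.
Proof.
have pow m : (16 ^ m = 4 ^ m.*2)%N by rewrite -mul2n expnM.
rewrite -[u]odd_double_half; set m := u./2; case: (odd u) => /=.
  have le2 : ('C(m.*2.+1, j) <= 2 * 'C(m.*2, m))%N.
    case: j => [|j]; first by have := bin_le_central m 0; rewrite !bin0; lia.
    by rewrite binS mulSn mul1n leq_add ?bin_le_central.
  rewrite add1n (expnS 4) -pow; have := central_bin_le m.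
  have := leq_mul le2 le2; rewrite -!mulnn; nia.
rewrite add0n -pow; have := central_bin_le m.
have := leq_mul (bin_le_central m j) (bin_le_central m j); rewrite -!mulnn; nia.
Qed.

(** * An LYM-type inequality for sets with sum in a window *)

Section Windows.
Variables (R : realFieldType) (I : finType).
Implicit Types (a : I -> R) (m beta : R) (T A B D S L : {set I}).

(** Double counting: [A] lies in [T :\ i] for [#|T| - #|A|] choices of [i] in [T]. The weight is the
    probability that a uniform maximal chain passes through [A], here averaged over the element of
    [T] removed first. *)
Lemma proper_lym_sum T (P : pred {set I}) :
  \sum_(A : {set I} | (A \proper T) && P A) ('C(#|T|, #|A|)%:R)^-1 =
  \sum_(i in T) #|T|%:R^-1 *
    \sum_(A : {set I} | (A \subset T :\ i) && P A) ('C(#|T :\ i|, #|A|)%:R)^-1 :> R.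
Proof.
under [RHS]eq_bigr do rewrite mulr_sumr.
rewrite (exchange_big_dep (fun A => (A \proper T) && P A)) /=; last first.
  move=> i A iT /andP[/subsetD1P[sAT niA] ->]; rewrite andbT properE sAT.
  by apply/negP => /subsetP/(_ i iT); rewrite (negPf niA).
apply: eq_bigr => A /andP[pAT PA]; have sAT := proper_sub pAT.
have -> : \sum_(i in T | (A \subset T :\ i) && P A)
      #|T|%:R^-1 * ('C(#|T :\ i|, #|A|)%:R)^-1 =
    \sum_(i in T :\: A) #|T|%:R^-1 * ('C(#|T|.-1, #|A|)%:R)^-1 :> R.
  apply: eq_big => [i|i /andP[iT _]]; last by rewrite (cardsD1 i T) iT.
  by rewrite PA andbT subsetD1 sAT in_setD andbC.
rewrite sumr_const cardsD (setIidPr sAT).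
have ltAT := proper_card pAT.
case ET: #|T| ltAT => [//|t] /=; rewrite ltnS => leAt.
have E := mul_bin_down t.+1 #|A|.
have nz : ((t.+1 - #|A|)%:R : R) != 0 by rewrite pnatr_eq0 -lt0n subn_gt0 ltnS.
rewrite -[RHS]mulr_natl -invfM -natrM E natrM invfM mulrA divff ?mul1r //.
Qed.

Definition setsum a A : R := \sum_(i in A) a i.

Lemma setsumD1 a T i : i \in T -> setsum a T = a i + setsum a (T :\ i).
Proof. by move=> iT; rewrite /setsum (big_setD1 i). Qed.

Lemma setsum_le a T A : (forall i, i \in T -> 0 <= a i) -> A \subset T ->
  setsum a A <= setsum a T.
Proof.
move=> a0 sAT; rewrite /setsum [leRHS](big_setID A) /= (setIidPr sAT) lerDl.
by apply: sumr_ge0 => i /setDP[iT _]; exact: a0.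
Qed.

(* A maximal chain of subsets meets the window in at most [k] sets, since the
   sums increase by at least [m] at each step. *)
Lemma lym_window a m beta T (k : nat) : 0 <= m -> (forall i, i \in T -> m <= a i) ->
  \sum_(A : {set I} | (A \subset T) && (beta <= setsum a A < beta + k%:R * m))
     ('C(#|T|, #|A|)%:R)^-1 <= k%:R :> R.
Proof.
move=> m0; have [t] := ubnP #|T|; elim: t T k => // t IH T k /ltnSE cT aT.
pose P j (A : {set I}) := beta <= setsum a A < beta + j%:R * m.
(* The number of steps [j] is left free: it is used for [k], and for [k] less one when [T] itself is
   in the window. *)
have avg j :
    \sum_(A : {set I} | (A \proper T) && P j A) ('C(#|T|, #|A|)%:R)^-1 <= j%:R :> R.
  rewrite proper_lym_sum; have [->|T0] := eqVneq T set0; first by rewrite big_set0.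
  have nzT : (#|T|%:R : R) != 0 by rewrite pnatr_eq0 cards_eq0.
  apply: (@le_trans _ _ (\sum_(i in T) #|T|%:R^-1 * j%:R)).
    apply: ler_sum => i iT; rewrite ler_wpM2l ?invr_ge0 // IH //.
      by rewrite (leq_trans _ cT) // [ltnRHS](cardsD1 i) iT.
    by move=> l /setD1P[_ /aT].
  by rewrite sumr_const -[leLHS]mulr_natl mulrA divff ?mul1r.
have [PT|PT] := boolP (P k T); last first.
  apply: le_trans (avg k); rewrite le_eqVlt; apply/orP; left; apply/eqP.
  apply: eq_bigl => A; rewrite properEneq -/(P k A).
  by case: eqVneq => //= ->; rewrite subxx (negPf PT).
rewrite (bigD1 T) /= ?subxx // binn invr1.
case: k PT => [|k] PT.
  by move: PT => /andP[]; rewrite mul0r addr0 => /le_lt_trans h /h; rewrite ltxx.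
rewrite -natr1 addrC lerD2r; apply: le_trans (avg k).
rewrite [leRHS](bigID (P k.+1)) /= ler_wpDr ?sumr_ge0 //.
  by move=> A _; rewrite invr_ge0.
rewrite le_eqVlt; apply/orP; left; apply/eqP; apply: eq_bigl => A.
rewrite properEneq -/(P k.+1 A) andbC; case: eqVneq => //= neqAT.
have [sAT /=|//] := boolP (A \subset T).
have [i iT niA] : exists2 i, i \in T & i \notin A.
  by apply/subsetPn; apply: contra neqAT => sTA; rewrite eqEsubset sAT.
(* As [A] misses an element of [T], its sum is at least one step below that of [T], hence in the
   window shortened by one step. The step gained pays for the term 1 of [T]. *)
have le1 : setsum a A + m <= setsum a T.
  rewrite (setsumD1 _ iT) addrC lerD ?aT //; apply: setsum_le.
    by move=> l /setD1P[_ /aT]; apply: le_trans.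
  by rewrite subsetD1 sAT.
have /andP[_] := PT; rewrite -natr1 mulrDl mul1r => ltT.
have lt0 : setsum a A < beta + k%:R * m by lra.
have lt1 : setsum a A < beta + (k%:R * m + m) by lra.
by rewrite /P lt0 -natr1 mulrDl mul1r lt1 andbb.
Qed.

Lemma card_window_pos a m beta T (k : nat) (M : R) :
    0 <= m -> (forall i, i \in T -> m <= a i) ->
    (forall j, 'C(#|T|, j)%:R <= M) ->
  #|[set A : {set I} | (A \subset T) && (beta <= setsum a A < beta + k%:R * m)]|%:R
    <= k%:R * M.
Proof.
move=> m0 aT leM; have M0 : 0 <= M by apply: le_trans (leM 0); rewrite ler0n.
apply: le_trans (ler_wpM2r M0 (lym_window beta k m0 aT)).
rewrite mulr_suml -sum1_card natr_sum big_mkcond /= [leRHS]big_mkcond /=.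
apply: ler_sum => A _; rewrite inE; case: ifP => // /andP[sAT _].
have C0 : 0 < ('C(#|T|, #|A|)%:R : R) by rewrite ltr0n bin_gt0 subset_leq_card.
by rewrite mulrC ler_pdivlMr ?mul1r.
Qed.

(** * Removing signs, and fixing the trace on a subset *)

Definition symdiff A B : {set I} := [set i | (i \in A) (+) (i \in B)].

Lemma symdiffK B : involutive (symdiff^~ B).
Proof. by move=> A; apply/setP=> i; rewrite !inE addbK. Qed.

Lemma card_symdiff A B : #|symdiff A B| = (#|A :\: B| + #|B :\: A|)%N.
Proof.
rewrite -(cardsID A (symdiff A B)) addnC [in LHS]addnC; congr (_ + _)%N;
  apply: eq_card => i.
  by rewrite !inE; case: (i \in A); case: (i \in B).
by rewrite !inE; case: (i \in A); case: (i \in B).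
Qed.

Lemma setsumE a A : setsum a A = \sum_i (if i \in A then a i else 0).
Proof. by rewrite /setsum big_mkcond. Qed.

(** Toggling the negative coordinates replaces [a] by its absolute value up to a constant shift,
    which only translates the window. *)
Lemma setsum_flip a T B : B \subset T ->
  let N := [set i in T | a i < 0] in
  setsum a (symdiff B N) = setsum (fun i => `|a i|) B + setsum a N.
Proof.
move=> sBT N; rewrite !setsumE -big_split; apply: eq_bigr => i _ /=.
rewrite !inE; have [iB|niB] := boolP (i \in B).
  by rewrite (subsetP sBT) //=; case: ltP => [/ltr0_norm|/ger0_norm] -> /=; lra.
by rewrite /= add0r.
Qed.

Lemma card_window a m beta T (k : nat) (M : R) :
    0 <= m -> (forall i, i \in T -> m <= `|a i|) ->
    (forall j, 'C(#|T|, j)%:R <= M) ->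
  #|[set A : {set I} | (A \subset T) && (beta <= setsum a A < beta + k%:R * m)]|%:R
    <= k%:R * M.
Proof.
move=> m0 aT leM; pose N := [set i in T | a i < 0].
apply: le_trans (card_window_pos (beta - setsum a N) k m0 aT leM).
rewrite ler_nat; apply: leq_trans (leq_imset_card (symdiff^~ N) _).
apply/subset_leq_card/subsetP => A; rewrite inE => /andP[sAT].
have sB : symdiff A N \subset T.
  apply/subsetP => i; rewrite !inE; have [/(subsetP sAT)->//|_] := boolP (i \in A).
  by case/andP.
rewrite -{1 2}(symdiffK N A) (setsum_flip a sB) => win.
by apply/imsetP; exists (symdiff A N); rewrite ?symdiffK // inE sB; lra.
Qed.

(** Among sets with trace [D] on [L], the sum over [L] is constant, so each of the [2 ^ #|L|] fibers
    is a window problem on the complement, translated by [setsum a D]. *)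
Lemma card_window_fibers a m beta L (k : nat) (M : R) :
    0 <= m -> (forall i, i \notin L -> m <= `|a i|) ->
    (forall j, 'C(#|~: L|, j)%:R <= M) ->
  #|[set A : {set I} | beta <= setsum a A < beta + k%:R * m]|%:R
    <= (2 ^+ #|L|) * (k%:R * M).
Proof.
move=> m0 aL leM; set W := [set _ | _].
rewrite -sum1_card (partition_big (fun A => A :&: L) (mem (powerset L))) /=; last first.
  by move=> A _; rewrite powersetE subsetIr.
rewrite natr_sum -natrX -card_powerset mulr_natl -sumr_const.
apply: ler_sum => D; rewrite powersetE => sDL; rewrite sum1_card.
have aT i : i \in ~: L -> m <= `|a i| by move=> iL; apply: aL; rewrite -in_setC.
apply: le_trans (card_window (beta - setsum a D) k m0 aT leM).
rewrite ler_nat; apply: leq_trans (leq_imset_card (setU D) _).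
apply/subset_leq_card/subsetP => A; rewrite unfold_in /= inE => /andP[win /eqP eqD].
have sA : setsum a A = setsum a D + setsum a (A :\: L).
  by rewrite /setsum (big_setID L) eqD.
apply/imsetP; exists (A :\: L); last by rewrite -eqD setID.
by rewrite inE subsetDr /=; lra.
Qed.

(** * Flipping small coordinates *)

Lemma setsum_symdiff a m A S : (forall i, i \in S -> `|a i| <= m) ->
  `|setsum a (symdiff A S) - setsum a A| <= #|S|%:R * m.
Proof.
move=> aS; rewrite !setsumE -sumrB; apply: le_trans (ler_norm_sum _ _ _) _.
rewrite mulr_natl -sumr_const [leRHS]big_mkcond /=; apply: ler_sum => i _.
rewrite inE; have := aS i; case: (i \in A) (i \in S) => [] [] //= h.
- by rewrite sub0r normrN h.
- by rewrite subrr normr0.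
- by rewrite subr0 h.
- by rewrite subrr normr0.
Qed.

(** The map is injective: if two pairs have the same image, [A] and [B] differ exactly where [S] and
    [S'] do, in at most [2r] places, so [A = B] and then [S = S']. *)
Lemma card_code (F : {set {set I}}) L r :
  {in F &, forall A B, A != B -> (2 * r < #|symdiff A B|)%N} ->
  (#|F| * 'C(#|L|, r) =
   #|[set symdiff p.1 p.2 | p in setX F [set S : {set I} | S \subset L & #|S| == r]]|)%N.
Proof.
move=> codeF; rewrite card_in_imset ?cardsX ?cards_draws // => -[A S] [B S'] /=.
rewrite !inE /= => /andP[FA /andP[_ /eqP cS]] /andP[FB /andP[_ /eqP cS']] eqAB.
have xorE : symdiff A B = symdiff S S'.
  apply/setP => i; have /setP/(_ i) := eqAB; rewrite !inE.
  by case: (i \in A) (i \in B) (i \in S) (i \in S') => [] [] [] [].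
have eqA : A = B.
  apply/eqP; apply: contraT => /(codeF A B FA FB); rewrite xorE card_symdiff.
  have := subset_leq_card (subsetDl S S'); have := subset_leq_card (subsetDl S' S).
  by rewrite cS cS'; lia.
congr (_, _) => //; apply/setP => i; have /setP/(_ i) := xorE.
by rewrite eqA !inE addbb; case: (i \in S) (i \in S') => [] [].
Qed.

(** Greedy selection: the next index is a minimizer outside [L], and [m] is the least absolute value
    left. That [m] is attained serves later to show it nonzero. *)
Lemma median_split a (k : nat) : (k < #|I|)%N ->
  exists L, exists m : R, [/\ #|L| = k, exists i, m = `|a i|,
    forall i, i \in L -> `|a i| <= m & forall i, i \notin L -> m <= `|a i|].
Proof.
have min L : (#|L| < #|I|)%N ->
      exists2 i, i \notin L & forall j, j \notin L -> `|a i| <= `|a j|.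
  move=> ltL; have /card_gt0P[i0] : (0 < #|~: L|)%N by rewrite cardsCs setCK subn_gt0.
  rewrite inE => ni0; pose f i := `|a i|.
  by case: (arg_minP (P := fun i => i \notin L) f ni0) => i; exists i.
elim: k => [|k IH] ltk.
  have [|i _ mi] := min set0; first by rewrite cards0.
  by exists set0, `|a i|; split; [rewrite cards0 | exists i | move=> j; rewrite inE | ].
have [L [m [cL _ mL mL']]] := IH (ltnW ltk).
have [|i niL mi] := min L; first by rewrite cL ltnW.
have cL' : #|i |: L| = k.+1 by rewrite cardsU1 niL cL.
have [|j nj mj] := min (i |: L); first by rewrite cL'.
have lij : `|a i| <= `|a j| by apply: mi; move: nj; rewrite !inE negb_or => /andP[].
exists (i |: L), `|a j|; split=> //; first by exists j.
move=> l; rewrite !inE => /predU1P[->//|lL].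
by apply: le_trans lij; apply: le_trans (mL _ lL) (mL' _ niL).
Qed.

End Windows.

(** * Estimates in [n] and passage to subsets *)

(** Factor by factor in the falling factorial: [n <= 4 (n./2 - i)] for [i < r]. *)
Lemma exp_le_bin_half n r : (4 * r <= n)%N -> (n ^ r <= 'C(n./2, r) * (r`! * 4 ^ r))%N.
Proof.
move=> len; rewrite mulnA bin_ffact ffact_prod.
rewrite -[r in (_ ^ r <= _)%N]card_ord -[r in (_ * 4 ^ r)%N]card_ord.
rewrite -!prod_nat_const -big_split /=.
by apply: leq_prod => i _; have := ltn_ord i; have := odd_double_half n; lia.
Qed.

Lemma bin_le_sqrt (R : rcfType) n u j : (0 < n)%N -> (n <= 2 * u.+1)%N ->
  'C(u, j)%:R <= 2 * 2 ^+ u / Num.sqrt n%:R :> R.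
Proof.
move=> n0 len; have s0 : 0 < Num.sqrt (n%:R : R) by rewrite sqrtr_gt0 ltr0n.
rewrite ler_pdivlMr // -ler_sqr ?nnegrE ?mulr_ge0 ?exprn_ge0 ?ler0n //; last exact: ltW.
rewrite exprMn sqr_sqrtr ?ler0n // -!natrX -natrM -natrX -natrM ler_nat.
have := bin_sqr_le u j; have -> : (4 ^ u = (2 ^ u) ^ 2)%N by rewrite -expnM mulnC expnM.
rewrite expnMn; nia.
Qed.

Lemma prob_sum_eqE (R : realType) n (a : 'I_n -> R) alpha :
  prob_sum_eq a alpha = #|[set A | setsum a A == alpha]|%:R / 2 ^+ n.
Proof.
rewrite /prob_sum_eq; congr (_%:R / _).
pose f (A : {set 'I_n}) := [ffun i => i \in A].
have fI : injective f.
  by move=> A B /ffunP e; apply/setP => i; have := e i; rewrite !ffunE.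
rewrite -(card_imset _ fI); apply: eq_card => e; rewrite inE.
have sE (A : {set 'I_n}) : \sum_(i < n) (f A i)%:R * a i = setsum a A.
  rewrite setsumE; apply: eq_bigr => i _.
  by rewrite ffunE; case: ifP; rewrite ?mul1r ?mul0r.
have -> : e = f [set i | e i] by apply/ffunP => i; rewrite ffunE inE.
by rewrite sE mem_imset // inE.
Qed.

(** * Counting the solutions *)

Section Count.
Variables (R : rcfType) (n r : nat) (a : 'I_n -> R) (alpha : R).
Hypothesis n_gt0 : (0 < n)%N.
Hypothesis r_gt0 : (0 < r)%N.
Hypothesis dissociated : forall x y : {set 'I_n}, [disjoint x & y] ->
  (x != set0) || (y != set0) -> (#|x| + #|y| <= 2 * r)%N ->
  \sum_(i in x) a i != \sum_(j in y) a j.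

(** Cancelling [A :&: B] leaves the disjoint sets [A :\: B] and [B :\: A] with equal sums, which the
    hypothesis forbids when they are small. *)
Lemma solutions_code :
  {in [set A | setsum a A == alpha] &,
    forall A B, A != B -> (2 * r < #|symdiff A B|)%N}.
Proof.
move=> A B; rewrite !inE => /eqP sA /eqP sB neqAB; rewrite ltnNge card_symdiff.
apply/negP => le2r.
have dis : [disjoint A :\: B & B :\: A].
  by apply/pred0P => i /=; rewrite !inE; case: (i \in A); rewrite ?andbF.
have ne : (A :\: B != set0) || (B :\: A != set0).
  by rewrite -negb_and !setD_eq0 -eqEsubset.
case/eqP: (dissociated dis ne le2r).
move: sA sB; rewrite /setsum (big_setID B) /= => <-.
by rewrite (big_setID A) /= setIC => /addrI.
Qed.

Lemma card_solutions_bin :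
  #|[set A | setsum a A == alpha]|%:R * 'C(n./2, r)%:R
    <= 2 ^+ n * (2 * (2 * r).+1%:R) / Num.sqrt n%:R :> R.
Proof.
have hn := odd_double_half n.
have [|L [m [cL [i0 Em] mL mU]]]
  := @median_split R 'I_n a n./2; first by rewrite card_ord; lia.
(* Dissociation of a singleton from the empty set excludes zero coefficients; this needs
   [r >= 1]. *)
have m0 : 0 < m.
  rewrite Em normr_gt0; have := @dissociated [set i0] set0.
  rewrite big_set1 big_set0; apply.
  - by rewrite disjoints_subset setC0 subsetT.
  - by rewrite -card_gt0 cards1.
  - by rewrite cards1 cards0; lia.
have cU : #|~: L| = (n - n./2)%N by rewrite cardsCs setCK card_ord cL.
pose M : R := 2 * 2 ^+ (n - n./2) / Num.sqrt n%:R.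
have leM j : 'C(#|~: L|, j)%:R <= M by rewrite cU; apply: bin_le_sqrt => //; lia.
have -> : 2 ^+ n * (2 * (2 * r).+1%:R) / Num.sqrt n%:R = 2 ^+ #|L| * ((2 * r).+1%:R * M).
  by rewrite cL -{1}(@subnKC n./2 n) ?exprD /M; [ring | lia].
(* The interval from [alpha - r m] to [alpha + r m] has [2r] steps; one more step makes the
   half-open window contain its right end, as [m > 0]. *)
apply: le_trans (card_window_fibers (alpha - r%:R * m) _ (ltW m0) mU leM).
rewrite -natrM ler_nat -cL (card_code _ solutions_code).
apply/subset_leq_card/subsetP => B /imsetP[[A S] /setXP[/=]].
rewrite !inE => /eqP sA /andP[sSL /eqP cS] ->.
have := @setsum_symdiff _ _ a m A S (fun i iS => mL i (subsetP sSL i iS)).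
rewrite sA cS ler_norml => /andP[h1 h2].
have -> : (2 * r).+1%:R = 1 + 2 * r%:R :> R by rewrite -natr1 natrM addrC.
by apply/andP; split; lra.
Qed.
End Count.

(* n^{-r-1/2} is written as 1 / (n^r * sqrt n). *)
Theorem theorem2 (R : realType) (r : nat) (hr : (1 <= r)%N) :
  exists C : R, 0 < C /\
  forall (n : nat), (1 <= n)%N -> forall a : 'I_n -> R,
    (forall x y : {set 'I_n}, [disjoint x & y] -> (x != set0) || (y != set0) ->
       (#|x| + #|y| <= 2 * r)%N -> \sum_(i in x) a i != \sum_(j in y) a j) ->
    forall alpha : R,
      prob_sum_eq a alpha <= C / (n%:R ^+ r * Num.sqrt (n%:R)).
Proof.
(* [K1] covers [n < 4r], where the probability is at most 1 and [n^r sqrt n <= n^(r+1)]. [K2] covers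
   [n >= 4r]: it is the constant of [card_solutions_bin] times the loss in replacing ['C(n./2, r)]
   by [n^r]. *)
pose K1 : R := ((4 * r) ^ r.+1)%:R.
pose K2 : R := 2 * (2 * r).+1%:R * (r`! * 4 ^ r)%:R.
have K1_gt0 : 0 < K1 by rewrite ltr0n expn_gt0; lia.
have K2_ge0 : 0 <= K2 by rewrite /K2 !mulr_ge0.
exists (K1 + K2); split=> [|n n_gt0 a dissoc alpha]; first exact: ltr_pwDl.
have s0 : 0 < Num.sqrt (n%:R : R) by rewrite sqrtr_gt0 ltr0n.
have nr0 : 0 < (n%:R : R) ^+ r by rewrite exprn_gt0 ?ltr0n.
rewrite prob_sum_eqE ler_pdivlMr ?mulr_gt0 // mulrAC ler_pdivrMr ?exprn_gt0 //.
set F := [set _ | _].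
have [len|ltn] := leqP (4 * r) n.
  apply: (@le_trans _ _ (K2 * 2 ^+ n)); last by rewrite ler_wpM2r ?exprn_ge0 // lerDr ltW.
  have := card_solutions_bin alpha n_gt0 hr dissoc; rewrite -/F ler_pdivlMr // => leF.
  have lebin : (n%:R : R) ^+ r <= 'C(n./2, r)%:R * (r`! * 4 ^ r)%:R.
    by rewrite -natrX -natrM ler_nat exp_le_bin_half.
  apply: (@le_trans _ _ (#|F|%:R * 'C(n./2, r)%:R * Num.sqrt n%:R * (r`! * 4 ^ r)%:R)).
    rewrite [leRHS](_ : _ = #|F|%:R *
      (('C(n./2, r)%:R * (r`! * 4 ^ r)%:R) * Num.sqrt n%:R)); last by ring.
    by rewrite ler_wpM2l ?ler0n // ler_wpM2r // ltW.
  rewrite [leRHS](_ : _ = (2 ^+ n * (2 * (2 * r).+1%:R)) * (r`! * 4 ^ r)%:R).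
    by rewrite ler_wpM2r.
  by rewrite /K2; ring.
have leF : #|F|%:R <= 2 ^+ n :> R.
  rewrite -natrX ler_nat -[n in (2 ^ n)%N](card_ord n) -cardsT -card_powerset.
  by apply/subset_leq_card/subsetP => A _; rewrite powersetE subsetT.
rewrite mulrC ler_pM ?ler0n ?mulr_ge0 ?(ltW nr0) ?(ltW s0) //.
apply: (@le_trans _ _ K1); last by rewrite lerDl.
have sn : Num.sqrt (n%:R : R) <= n%:R.
  rewrite -ler_sqr ?nnegrE ?sqrtr_ge0 ?ler0n // sqr_sqrtr ?ler0n //.
  by rewrite -natrX ler_nat -mulnn leq_pmull.
apply: (@le_trans _ _ (n%:R ^+ r * n%:R)); first by rewrite ler_wpM2l // ltW.
by rewrite -exprSr -natrX ler_nat leq_exp2r // ltnW.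
Qed.
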